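(* Let $d\in\mathbb{N}_+$ and $\mathbf{n}=(n_1,\dots,n_d)\in\mathbb{N}_+^d$. The ideal $I_2\subset\mathbb{R}[X]$ is real radical and prime, its real variety $\mathcal{V}_{\mathbb{R}}(I_2)\subset\mathbb{R}^{\mathbf{n}}$ is irreducible, and the unit ball $B_2$ of the nuclear $2$-norm on $\mathbb{R}^{\mathbf{n}}$ is the convex hull of this variety: $B_2=\operatorname{conv}(\mathcal{V}_{\mathbb{R}}(I_2))$. Moreover, for each $p\in\{0,1,\infty\}$ the ideal $I_p\subset\mathbb{R}[X]$ is real radical.
   Context: Let $[n]=\{1,\dots,n\}$, $[\mathbf{n}]=[n_1]\times\cdots\times[n_d]$, and $\mathbb{R}[X]=\mathbb{R}[x_a : a\in[\mathbf{n}]]$, the polynomial ring in the entries of tensors in $\mathbb{R}^{\mathbf{n}}=\mathbb{R}^{n_1}\otimes\cdots\otimes\mathbb{R}^{n_d}$. For $a,b\in[\mathbf{n}]$ let $a\wedge b=(\min\{a_1,b_1\},\dots,\min\{a_d,b_d\})$ and $a\vee b=(\max\{a_1,b_1\},\dots,\max\{a_d,b_d\})$. Let $\mathcal{S}=\{(a,b)\in[\mathbf{n}]^2 : \exists\, i,j\in[d],\ a_i>b_i,\ a_j<b_j\}$. The rank-1 binomials are the polynomials $x_ax_b-x_{a\vee b}x_{a\wedge b}$ with $(a,b)\in\mathcal{S}$. Define $$I_0=\langle \text{rank-1 binomials}\rangle,\qquad I_2=\Big\langle \sum_{a\in[\mathbf{n}]}x_a^2-1\Big\rangle+I_0,$$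 $$I_1=\Big\langle \sum_{a\in[\mathbf{n}]}x_a^2-1,\ x_a^3-x_a\ (a\in[\mathbf{n}]),\ x_ax_b\ (a\neq b\in[\mathbf{n}])\Big\rangle,\qquad I_\infty=\langle x_a^2-1\ (a\in[\mathbf{n}])\rangle+I_0.$$ The unit ball $B_2$ of the nuclear ($2$-)norm is the convex hull of all rank-one tensors $u^{(1)}\otimes\cdots\otimes u^{(d)}$ of Euclidean (Frobenius) norm $1$; equivalently, the nuclear norm is $\|T\|_*=\inf\{\sum_{j}|\lambda_j| : T=\sum_{j}\lambda_j\, u_j^{(1)}\otimes\cdots\otimes u_j^{(d)},\ \|u_j^{(i)}\|_2=1\}$ (finite sums). $\mathcal{V}_{\mathbb{R}}(I)$ is the set of real common zeros of $I$. Irreducibility refers to the Zariski topology. The real radical of an ideal $I\subseteq\mathbb{R}[X]$ is $\{f\in\mathbb{R}[X] : f^{2r}+\sum_{i=1}^l g_i^2\in I \text{ for some } r>0,\ g_i\in\mathbb{R}[X]\}$, and $I$ is real radical (also called real reduced) if it equals its real radical.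
   Formalization: The claims that I_2 is prime and that its real variety is irreducible are made only when some n_i ≥ 2; for n = (1,…,1) they are false, as I_2 = ⟨x²−1⟩ is not prime and its variety {1,−1} is reducible. *)

(* Defs.v *)
From HB Require Import structures.
From mathcomp Require Import all_boot all_order all_algebra.
From mathcomp Require Import boolp classical_sets reals.
From mathcomp Require Import mpoly.
(* Only the algebraic structures of polynomials are re-exported: the notations
   of mpoly clash with those of the topology files of mathcomp-analysis. *)
Export (canonicals, coercions) mpoly.

Set Implicit Arguments.
Unset Strict Implicit.
Unset Printing Implicit Defensive.

Import Order.TTheory GRing.Theory Num.Theory.
Local Open Scope ring_scope.
Local Open Scope classical_set_scope.

Section Ideals.
Variable P : comNzRingType.

Definition ideal_gen (G : set P) : set P :=
  [set f | exists (m : nat) (c g : 'I_m -> P),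
     (forall j, G (g j)) /\ f = \sum_(j < m) c j * g j].

Definition ideal_add (I J : set P) : set P :=
  [set f | exists g h : P, [/\ I g, J h & f = g + h]].

(* [idealr_closed] includes properness, 1 \notin I. *)
Definition is_prime_ideal (I : set P) : Prop :=
  idealr_closed [pred f | f \in I] /\ prime_idealr_closed [pred f | f \in I].

Definition real_radical (I : set P) : set P :=
  [set f | exists (r l : nat) (g : 'I_l -> P),
     (0 < r)%N /\ I (f ^+ (2 * r) + \sum_(i < l) g i ^+ 2)].

Definition is_real_radical (I : set P) : Prop := real_radical I = I.

End Ideals.

Section ConvexHull.
Variables (R : realType) (X : finType).

Definition convex_hull (A : set {ffun X -> R}) : set {ffun X -> R} :=
  [set T | exists (m : nat) (w : 'I_m -> R) (v : 'I_m -> {ffun X -> R}),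
     [/\ forall j, 0 <= w j, \sum_(j < m) w j = 1, forall j, A (v j)
       & T = [ffun x => \sum_(j < m) w j * v j x]]].

End ConvexHull.

Section AffineSpace.
Variables (R : realType) (X : finType).

(* Polynomials in the indeterminates x_a, a : X; the library numbers its
   indeterminates, and [enum_rank] / [enum_val] is the bijection
   between X and 'I_#|X|. *)
Local Notation rpoly := {mpoly R[#|X|]}.

Definition var (a : X) : rpoly := 'X_(enum_rank a).

Definition peval (T : {ffun X -> R}) (f : rpoly) : R :=
  f.@[fun k => T (enum_val k)].

Definition zero_locus (F : set rpoly) : set {ffun X -> R} :=
  [set T | forall f, F f -> peval T f = 0].

Definition zariski_closed (A : set {ffun X -> R}) : Prop :=
  exists F : set rpoly, A = zero_locus F.

(* Irreducibility of V for the topology induced by the Zariski topology. *)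
Definition zariski_irreducible (V : set {ffun X -> R}) : Prop :=
  V !=set0 /\
  forall A B : set {ffun X -> R}, zariski_closed A -> zariski_closed B ->
    V `<=` A `|` B -> V `<=` A \/ V `<=` B.

End AffineSpace.

Section Tensors.
Variables (R : realType) (d : nat) (n : 'I_d -> nat).

(* The index set [n_1] x ... x [n_d], each [n_i] shifted to {0, .., n_i - 1}. *)
Local Notation idx := {dffun forall i : 'I_d, 'I_(n i)}.
Local Notation tensor := {ffun idx -> R}.
Local Notation rpoly := {mpoly R[#|{: idx}|]}.

Definition norm2 (k : nat) (u : 'I_k -> R) : R := Num.sqrt (\sum_c u c ^+ 2).

Definition tprod (u : forall i : 'I_d, 'I_(n i) -> R) : tensor :=
  [ffun a : idx => \prod_(i < d) u i (a i)].

Definition nuclear_norm (T : tensor) : R :=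
  inf [set s | exists (m : nat) (lam : 'I_m -> R)
                      (u : 'I_m -> forall i : 'I_d, 'I_(n i) -> R),
         [/\ forall j i, norm2 (u j i) = 1,
             T = [ffun a => \sum_(j < m) lam j * tprod (u j) a]
           & s = \sum_(j < m) `|lam j|]].

Definition nuclear_ball : set tensor := [set T | nuclear_norm T <= 1].

Definition idx_meet (a b : idx) : idx := [ffun i => Order.min (a i) (b i)].
Definition idx_join (a b : idx) : idx := [ffun i => Order.max (a i) (b i)].

Definition incomparable (a b : idx) : Prop :=
  exists i j : 'I_d, (b i < a i)%N /\ (a j < b j)%N.

Local Notation x := (@var R idx).

Definition rank1_binomials : set rpoly :=
  [set f | exists a b : idx, incomparable a b /\
     f = x a * x b - x (idx_join a b) * x (idx_meet a b)].

Definition sphere_poly : rpoly := \sum_(a : idx) x a ^+ 2 - 1.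

Definition I0 : set rpoly := ideal_gen rank1_binomials.

Definition I1 : set rpoly :=
  ideal_gen ([set sphere_poly]
             `|` [set f | exists a : idx, f = x a ^+ 3 - x a]
             `|` [set f | exists a b : idx, a <> b /\ f = x a * x b]).

Definition I2 : set rpoly := ideal_add (ideal_gen [set sphere_poly]) I0.

Definition Iinfty : set rpoly :=
  ideal_add (ideal_gen [set f | exists a : idx, f = x a ^+ 2 - 1]) I0.

End Tensors.

Arguments nuclear_ball : clear implicits.
Arguments I0 : clear implicits.
Arguments I1 : clear implicits.
Arguments I2 : clear implicits.
Arguments Iinfty : clear implicits.

(* Main.v *)
(* An ideal containing every polynomial vanishing on its real zero locus is real
   radical, and all four ideals have this property.
   - I_0 is the ideal of the rank-one tensors: swapping one coordinate of two
     indices preserves their meet and join, so modulo I_0 monomials with the same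
     marginals agree, while those with different marginals are independent
     functions on rank-one tensors.
   - I_2: the even and odd parts of a polynomial vanishing on the symmetric set
     V(I_2) become homogeneous, modulo |x|^2 - 1, on multiplication of their terms
     by powers of |x|^2; they then vanish on the cone V(I_0).
   - I_1 and I_infty contain all x_a^3 - x_a, which gives a finite reduced scheme.
   V(I_2) consists of the products of unit vectors; any two of its points lie on a
   rational curve, whence primality. Every nuclear decomposition can be reduced to
   a bounded number of terms without increasing its cost (Caratheodory), so the
   nuclear norm is attained by compactness, and the unit ball is the convex hull. *)
From HB Require Import structures.
Require Import Defs.
From mathcomp Require Import all_boot all_order all_algebra.
From mathcomp Require Import boolp classical_sets reals.
From mathcomp Require mpoly.
From mathcomp Require Import topology normedtype.
From mathcomp Require Import ring lra.

Set Implicit Arguments.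
Unset Strict Implicit.
Unset Printing Implicit Defensive.

Import Order.TTheory GRing.Theory Num.Theory.
Import numFieldNormedType.Exports.
Local Open Scope ring_scope.
Local Open Scope classical_set_scope.

(** * Generated ideals, sums of ideals and congruence modulo an ideal *)

Section IdealTheory.
Variable P : comNzRingType.
Implicit Types (I J G : set P) (f g h : P).

Definition is_ideal I : Prop :=
  [/\ I 0, forall f g, I f -> I g -> I (f + g) & forall c f, I f -> I (c * f)].

Lemma ideal_gen_ideal G : is_ideal (ideal_gen G).
Proof.
split=> [|f g|c f].
- by exists 0, (fun=> 0), (fun=> 0); split=> [[]//|]; rewrite big_ord0.
- move=> [m [c [u [Gu ->]]]] [k [e [v [Gv ->]]]].
  pose pick T (a : 'I_m -> T) (b : 'I_k -> T) (j : 'I_(m + k)) :=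
    match split j with inl i => a i | inr i => b i end.
  exists (m + k)%N, (pick _ c e), (pick _ u v); split.
    by move=> j; rewrite /pick; case: (split j).
  rewrite big_split_ord; congr (_ + _); apply: eq_bigr => j _; rewrite /pick.
    by rewrite (unsplitK (inl j)).
  by rewrite (unsplitK (inr j)).
- move=> [m [e [u [Gu ->]]]]; exists m, (fun j => c * e j), u; split=> //.
  by rewrite mulr_sumr; apply: eq_bigr => j _; rewrite mulrA.
Qed.

Lemma sub_ideal_gen G : G `<=` ideal_gen G.
Proof.
move=> f Gf; exists 1, (fun=> 1), (fun=> f); split=> //.
by rewrite big_ord1 mul1r.
Qed.

Lemma ideal_add_ideal I J : is_ideal I -> is_ideal J -> is_ideal (ideal_add I J).
Proof.
move=> [I0 ID IM] [J0 JD JM]; split=> [|f g|c f].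
- by exists 0, 0; split=> //; rewrite addr0.
- move=> [a [b [Ia Jb ->]]] [a' [b' [Ia' Jb' ->]]]; exists (a + a'), (b + b').
  by split; [exact: ID|exact: JD|ring].
- move=> [a [b [Ia Jb ->]]]; exists (c * a), (c * b).
  by split; [exact: IM|exact: JM|rewrite mulrDr].
Qed.

Lemma ideal_addl I J : is_ideal J -> I `<=` ideal_add I J.
Proof. by move=> [J0 _ _] f If; exists f, 0; split; rewrite ?addr0. Qed.

Lemma ideal_addr I J : is_ideal I -> J `<=` ideal_add I J.
Proof. by move=> [I0 _ _] f If; exists 0, f; split; rewrite ?add0r. Qed.

Section Closure.
Variable I : set P.
Hypothesis idI : is_ideal I.

Lemma ideal0 : I 0. Proof. by case: idI. Qed.
Lemma idealD f g : I f -> I g -> I (f + g). Proof. by case: idI => _ + _; apply. Qed.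
Lemma idealMl c f : I f -> I (c * f). Proof. by case: idI => _ _; apply. Qed.
Lemma idealMr c f : I f -> I (f * c). Proof. by rewrite mulrC; apply: idealMl. Qed.
Lemma idealN f : I f -> I (- f). Proof. by rewrite -mulN1r; apply: idealMl. Qed.
Lemma idealB f g : I f -> I g -> I (f - g).
Proof. by move=> If Ig; apply: idealD => //; apply: idealN. Qed.

Lemma ideal_sum (K : Type) (s : seq K) (p : pred K) (F : K -> P) :
  (forall k, p k -> I (F k)) -> I (\sum_(k <- s | p k) F k).
Proof.
by move=> IF; elim/big_rec: _ => [|k f pk If]; [exact: ideal0|apply: idealD => //; exact: IF].
Qed.

Lemma ideal_cong_trans g f h : I (f - g) -> I (g - h) -> I (f - h).
Proof. by move=> Ifg Igh; rewrite -(subrK g f) -addrA; apply: idealD. Qed.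

Lemma ideal_cong f g : I (f - g) -> I g -> I f.
Proof. by move=> Ifg Ig; rewrite -[f](subrK g); apply: idealD. Qed.

End Closure.
End IdealTheory.

(** * Polynomials as functions; a sufficient condition for being real radical *)

Section PolynomialFunctions.
Variables (R : realType) (X : finType).
Local Notation rpoly := (mpoly.mpoly #|X| R).
Local Notation x := (@var R X).
Implicit Types (f g : rpoly) (T : {ffun X -> R}) (J : set rpoly).

HB.instance Definition _ T :=
  GRing.RMorphism.copy (peval T) (mpoly.meval (fun k => T (enum_val k))).

Lemma peval_var T a : peval T (x a) = T a.
Proof. by rewrite /peval /var mpoly.mevalXU enum_rankK. Qed.

Lemma pevalZ T c f : peval T (c *: f) = c * peval T f.
Proof. exact: mpoly.mevalZ. Qed.

Definition mon (m : {ffun X -> nat}) : rpoly := \prod_a x a ^+ m a.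

Lemma peval_mon T m : peval T (mon m) = \prod_a T a ^+ m a.
Proof. by rewrite rmorph_prod; apply: eq_bigr => a _; rewrite rmorphXn /= peval_var. Qed.

Lemma rpolyE f : exists s : seq (R * {ffun X -> nat}),
  f = \sum_(p <- s) p.1 *: mon p.2.
Proof.
exists [seq (mpoly.mcoeff m f, [ffun a => m (enum_rank a)]) | m <- mpoly.msupp f].
rewrite big_map [LHS]mpoly.mpolyE; apply: eq_bigr => m _ /=; congr (_ *: _).
rewrite mpoly.mpolyXE_id /mon (reindex enum_rank) /=; last exact/onW_bij/enum_rank_bij.
by apply: eq_bigr => a _; rewrite ffunE.
Qed.

Lemma rpoly_ind (Q : rpoly -> Prop) :
  (forall c, Q c%:A) -> (forall f g, Q f -> Q g -> Q (f + g)) ->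
  (forall f a, Q f -> Q (x a * f)) -> forall f, Q f.
Proof.
move=> Qc QD QM f; have [s ->] := rpolyE f.
apply: big_ind => //; first by rewrite -(scale0r 1); exact: Qc.
move=> [c m] _ /=; rewrite -[mon m]mulr1 scalerAr /mon.
apply: (big_ind (fun g => forall h, Q h -> Q (g * h))) => //.
- by move=> h; rewrite mul1r.
- by move=> g1 g2 Qg1 Qg2 h Qh; rewrite -mulrA; apply/Qg1/Qg2.
- move=> a _ h Qh; elim: (m a) => [|k IHk]; first by rewrite mul1r.
  by rewrite exprS -mulrA; apply: QM.
Qed.

Definition vanishing_ideal J := forall f, (forall T, zero_locus J T -> peval T f = 0) -> J f.

(** At a real zero of [J] the even power of [f] and the squares sum to zero, so each is zero and [f]
    vanishes there. *)
Lemma vanishing_real_radical J : vanishing_ideal J -> is_real_radical J.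
Proof.
move=> vJ; apply/seteqP; split=> f.
- move=> [r [l [g [r_gt0 Jfg]]]]; apply: vJ => T /(_ _ Jfg).
  rewrite rmorphD rmorphXn rmorph_sum /= => /eqP.
  rewrite mulnC exprM paddr_eq0 ?sqr_ge0 ?sumr_ge0 //; last first.
    by move=> i _; rewrite rmorphXn /= sqr_ge0.
  by case/andP; rewrite -exprM expf_eq0 muln_gt0 r_gt0 /= => /eqP.
- move=> Jf; exists 1, 0, (fun=> 0); split=> //; rewrite big_ord0 addr0.
  by apply: vJ => T /(_ _ Jf) fT; rewrite rmorphXn /= fT expr0n.
Qed.

Lemma scaler_ideal J c f : is_ideal J -> J f -> J (c *: f).
Proof. by move=> idJ Jf; rewrite -[f]mul1r scalerAl; apply: idealMl. Qed.

(* The real points of the ideal <x_a ^ 3 - x_a> are {0, 1, -1} ^ X; they are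
   separated by the orthogonal idempotents [\prod_a idem a (e a)]. *)
Lemma vanishing_finite J : is_ideal J -> (forall a, J (x a ^+ 3 - x a)) -> vanishing_ideal J.
Proof.
move=> idJ cubeJ f f0.
(* The [idem a k] are the Lagrange basis polynomials in [x a] for the nodes [pt k]: they sum to 1,
   and modulo the cubic [x a] acts on [idem a k] as the scalar [pt k]. *)
pose pt (k : 'I_3) : R := [:: 0; 1; -1]`_k.
pose idem a (k : 'I_3) : rpoly :=
  [:: 1 - x a ^+ 2; 2^-1 *: (x a ^+ 2 + x a); 2^-1 *: (x a ^+ 2 - x a)]`_k.
pose E (e : {ffun X -> 'I_3}) := \prod_a idem a (e a).
have sumE : \sum_e E e = 1.
  rewrite -(bigA_distr_bigA idem) big1 // => a _.
  rewrite !big_ord_recl big_ord0 /= /idem /= addr0 -scalerDr.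
  have -> : x a ^+ 2 + x a + (x a ^+ 2 - x a) = x a ^+ 2 + x a ^+ 2 by ring.
  rewrite scalerDr -scalerDl (_ : 2^-1 + 2^-1 = 1 :> R) ?scale1r ?subrK //.
  by field.
have idemJ a k : J (x a * idem a k - pt k *: idem a k).
  case: k => -[|[|[|//]]] lt_k; rewrite /idem /pt /=.
  - rewrite scale0r subr0 (_ : _ * _ = - (x a ^+ 3 - x a)); last by ring.
    exact: idealN.
  - rewrite scale1r -scalerAr -scalerBr; apply: scaler_ideal => //.
    by rewrite (_ : _ - _ = x a ^+ 3 - x a) //; ring.
  - rewrite scaleN1r opprK -scalerAr -scalerDr; apply: scaler_ideal => //.
    by rewrite (_ : _ + _ = x a ^+ 3 - x a) //; ring.
pose p e : {ffun X -> R} := [ffun a => pt (e a)].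
have EJ e a : J (x a * E e - p e a *: E e).
  rewrite /E (bigD1 a) //= mulrA scalerAl -mulrBl ffunE.
  exact: idealMr.
have evalJ e g : J (g * E e - peval (p e) g *: E e).
  elim/rpoly_ind: g => [c|g h Jg Jh|g a Jg].
  - rewrite pevalZ rmorph1 mulr1 -scalerAl mul1r subrr; exact: ideal0.
  - rewrite mulrDl rmorphD /= scalerDl opprD addrACA; exact: idealD.
  - rewrite -mulrA rmorphM /= peval_var.
    apply: (@ideal_cong_trans _ _ idJ (peval (p e) g *: (x a * E e))).
      by rewrite scalerAr -mulrBr; apply: idealMl.
    by rewrite [p e a * _]mulrC -scalerA -scalerBr; apply: scaler_ideal.
rewrite -[f]mulr1 -sumE mulr_sumr; apply: ideal_sum => // e _.
have [Zp|] := pselect (zero_locus J (p e)).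
  by have := evalJ e f; rewrite f0 // scale0r subr0.
(* Outside the zero locus some [g] in [J] has a nonzero value at [p e]; since [g * E e] is congruent
   to that value times [E e], the idempotent [E e] lies in [J]. *)
move=> /existsNP[g /not_implyP[Jg /eqP gp]]; apply: idealMl => //.
rewrite -[E e]scale1r -(mulVf gp) -scalerA; apply: scaler_ideal => //.
rewrite -[_ *: _](subKr (g * E e)); apply: idealB => //; exact: idealMr.
Qed.

End PolynomialFunctions.

(** * Linear independence of monomial functions *)

Section MonomialIndependence.
Variable R : realType.

Lemma poly_vanishing_eq0 (q : {poly R}) : (forall t, q.[t] = 0) -> q = 0.
Proof.
move=> q0; apply: (@roots_geq_poly_eq0 _ _ [seq i%:R | i <- iota 0 (size q)]).
- by apply/allP => _ /mapP[i _ ->]; apply/rootP.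
- by rewrite map_inj_uniq ?iota_uniq // => i j /eqP; rewrite eqr_nat => /eqP.
- by rewrite size_map size_iota.
Qed.

(** With the other variables fixed, the sum is a polynomial in the first variable of [l], so its
    coefficients vanish as functions of the remaining ones. Exponents may repeat in [s], hence a
    conclusion about sums of coefficients. *)
Lemma monomials_independent (J : finType) (l : seq J) (s : seq (R * {ffun J -> nat})) :
  uniq l ->
  (forall y : J -> R, \sum_(p <- s) p.1 * \prod_(j <- l) y j ^+ p.2 j = 0) ->
  forall nu : {ffun J -> nat}, \sum_(p <- s | all (fun j => p.2 j == nu j) l) p.1 = 0.
Proof.
elim: l s => [|j l IHl] s /=.
  by move=> _ /(_ (fun=> 0)) + nu; under eq_bigr do rewrite big_nil mulr1.
case/andP=> jNl uniq_l s0 nu.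
have coef0 y : \sum_(p <- s | p.2 j == nu j) p.1 * \prod_(k <- l) y k ^+ p.2 k = 0.
  pose q := \sum_(p <- s) (p.1 * \prod_(k <- l) y k ^+ p.2 k) *: 'X^(p.2 j).
  have /(congr1 (fun q : {poly R} => q`_(nu j))) : q = 0.
    apply: poly_vanishing_eq0 => t.
    rewrite -(s0 (fun k => if k == j then t else y k)) horner_sum.
    apply: eq_bigr => p _; rewrite hornerZ hornerXn big_cons eqxx mulrAC mulrCA !mulrA.
    rewrite [p.1 * _]mulrC; congr (_ * _); apply: eq_big_seq => k kl.
    by case: eqP => // kj; rewrite -kj kl in jNl.
  rewrite /= coef0 coef_sum => q0; rewrite -[RHS]q0 big_mkcond /=; apply: eq_bigr => p _.
  by rewrite coefZ coefXn eq_sym; case: eqP; rewrite ?mulr1 ?mulr0.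
have := IHl [seq p : R * {ffun J -> nat} <- s | p.2 j == nu j] uniq_l _ nu.
by rewrite big_filter_cond; apply=> y; rewrite big_filter coef0.
Qed.

End MonomialIndependence.

(** * The ideal of rank-one tensors, by straightening monomials *)

Section SegreIdeal.
Variables (R : realType) (d : nat) (n : 'I_d -> nat).
Hypothesis d_gt0 : (0 < d)%N.
Local Notation idx := {dffun forall i : 'I_d, 'I_(n i)}.
Local Notation x := (@var R idx).
Local Notation I0 := (I0 R d n).
Implicit Types (a b c : idx).

Definition mix (p : pred 'I_d) a b : idx := [ffun i => if p i then a i else b i].

Lemma I0_ideal : is_ideal I0. Proof. exact: ideal_gen_ideal. Qed.

(** For comparable [a] and [b] the join and the meet are [a] and [b] again, so the binomial is
    zero. *)
Lemma straighten a b : I0 (x a * x b - x (idx_join a b) * x (idx_meet a b)).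
Proof.
have [ab|Nab] := pselect (incomparable a b).
  by apply: sub_ideal_gen; exists a, b.
suff [[-> ->]|[-> ->]] : (idx_join a b = a /\ idx_meet a b = b) \/
                         (idx_join a b = b /\ idx_meet a b = a).
- by rewrite subrr; exact: ideal0 I0_ideal.
- by rewrite mulrC subrr; exact: ideal0 I0_ideal.
have [/existsP[i ba_i]|/existsPn leab] := boolP [exists i, (b i < a i)%N].
  left; suff le j : (b j <= a j)%O.
    by split; apply/ffunP => j; rewrite ffunE; [apply: max_l|apply: min_r]; exact: le.
  rewrite leEord leqNgt; apply/negP => ab_j; apply: Nab; by exists i, j.
right; suff le j : (a j <= b j)%O.
  by split; apply/ffunP => j; rewrite ffunE; [apply: max_r|apply: min_l]; exact: le.
by rewrite leEord leqNgt.
Qed.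

Lemma swap_I0 p a b : I0 (x a * x b - x (mix p a b) * x (mix p b a)).
Proof.
have -> : x a * x b - x (mix p a b) * x (mix p b a) =
  (x a * x b - x (idx_join a b) * x (idx_meet a b)) -
  (x (mix p a b) * x (mix p b a) -
     x (idx_join (mix p a b) (mix p b a)) * x (idx_meet (mix p a b) (mix p b a))).
  have -> : idx_join (mix p a b) (mix p b a) = idx_join a b.
    by apply/ffunP => i; rewrite !ffunE; case: (p i); rewrite // maxC.
  have -> : idx_meet (mix p a b) (mix p b a) = idx_meet a b.
    by apply/ffunP => i; rewrite !ffunE; case: (p i); rewrite // minC.
  by ring.
by apply: idealB; [exact: I0_ideal|exact: straighten|exact: straighten].
Qed.

Definition same_marginals (s t : seq idx) : Prop :=
  forall i : 'I_d, perm_eq [seq a i | a : idx <- s] [seq a i | a : idx <- t].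

(** The coordinates in [l] are corrected one by one: swaps preserve marginals, so if the head does
    not have the value [e j] at [j], an element of the tail does, and swapping coordinate [j] with
    it repairs the head. *)
Lemma align_head (e c : idx) (t : seq idx) (l : seq 'I_d) :
  (forall i, e i \in [seq a i | a : idx <- c :: t]) ->
  exists c' t', [/\ same_marginals (c' :: t') (c :: t), forall i, i \in l -> c' i = e i
    & I0 (x c * \prod_(a <- t) x a - x c' * \prod_(a <- t') x a)].
Proof.
move=> et; elim: l => [|j l [c1 [t1 [st eqe I01]]]].
  exists c, t; split=> //; rewrite subrr; exact: ideal0 I0_ideal.
have [cj|/eqP cj] := eqVneq (c1 j) (e j).
  by exists c1, t1; split=> // i; rewrite inE => /predU1P[->|/eqe].
have /mapP[b bt1 ej] : e j \in [seq a j | a : idx <- t1].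
  by have := et j; rewrite -(perm_mem (st j)) /= inE => /predU1P[ej|//]; rewrite ej in cj.
have pt1 := perm_to_rem bt1.
exists (mix (pred1 j) b c1), (mix (pred1 j) c1 b :: rem b t1); split.
- move=> i; apply: perm_trans (st i) => /=.
  have := perm_map (fun a : idx => a i) pt1; rewrite -(perm_cons (c1 i)) => /perm_trans h.
  rewrite perm_sym; apply: h => /=; rewrite !ffunE /=; case: eqP => // _.
  by apply/permP => q /=; rewrite addnCA.
- move=> i; rewrite inE ffunE /=; case: eqP => [->//|_ /=]; exact: eqe.
- apply: (ideal_cong_trans I0_ideal I01); rewrite (perm_big _ pt1) /= !big_cons !mulrA -mulrBl.
  by apply: (idealMr I0_ideal); rewrite [_ c1 * _]mulrC; exact: swap_I0.
Qed.

Lemma same_marginals_I0 s t : same_marginals s t ->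
  I0 (\prod_(a <- s) x a - \prod_(a <- t) x a).
Proof.
elim: t s => [|e t IHt] [|c s] st.
- rewrite subrr; exact: ideal0 I0_ideal.
(* Marginals determine the length of the list only because there is at least one coordinate. *)
- by have /perm_size := st (Ordinal d_gt0).
- by have /perm_size := st (Ordinal d_gt0).
have [|c' [t' [st' eqe I0']]] := @align_head e c s (enum 'I_d).
  by move=> i; rewrite (perm_mem (st i)) inE eqxx.
have c'e : c' = e by apply/ffunP => i; apply: eqe; rewrite mem_enum.
rewrite !big_cons; apply: (ideal_cong_trans I0_ideal I0').
rewrite c'e -mulrBr; apply: (idealMl I0_ideal); apply: IHt => i.
by have := perm_trans (st' i) (st i); rewrite c'e /= perm_cons.
Qed.

Local Notation coords := {i : 'I_d & 'I_(n i)}.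

(** At [(i, c)] this is the exponent of [u i c] in the value of the monomial [m] at [tprod u]. *)
Definition marginal (m : {ffun idx -> nat}) : {ffun coords -> nat} :=
  [ffun z => (\sum_(a : idx | a (tag z) == tagged z) m a)%N].

Lemma marginal_I0 (m m' : {ffun idx -> nat}) :
  marginal m = marginal m' -> I0 (mon R m - mon R m').
Proof.
(* A monomial becomes the list of its indices with multiplicity, to which the swaps apply. *)
pose sq (m : {ffun idx -> nat}) := flatten [seq nseq (m a) a | a <- enum {: idx}].
have sqE k : mon R k = \prod_(a <- sq k) x a.
  rewrite big_flatten big_map enumT; apply: eq_bigr => a _.
  by rewrite big_nseq -Monoid.iteropE.
have sqM k i (c : 'I_(n i)) : count_mem c [seq (a : idx) i | a <- sq k] = marginal k (Tagged _ c).
  rewrite count_map count_flatten -map_comp sumnE big_map enumT ffunE [RHS]big_mkcond /=.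
  by apply: eq_bigr => a _; rewrite count_nseq /=; case: eqP; rewrite ?mul1n.
move=> mm'; rewrite !sqE; apply: same_marginals_I0 => i.
by apply/allP => c _; rewrite /= !sqM mm'.
Qed.

Lemma peval_mon_tprod (u : forall i : 'I_d, 'I_(n i) -> R) (m : {ffun idx -> nat}) :
  peval (tprod u) (mon R m) = \prod_(z : coords) u (tag z) (tagged z) ^+ marginal m z.
Proof.
rewrite peval_mon.
under [RHS]eq_bigr do rewrite ffunE expr_sum.
rewrite [RHS](exchange_big_dep xpredT) //=; apply: eq_bigr => a _.
rewrite ffunE -prodrXl (reindex_onto (fun i => Tagged (fun i => 'I_(n i)) (a i)) tag) /=.
  by apply: eq_bigl => i; rewrite !eqxx.
by move=> [i c] /= /eqP ->.
Qed.

(** Different marginals give different monomials in the entries of the factors, so by independence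
    the coefficients of each marginal class sum to zero; modulo [I0] a class collapses to one
    monomial times this sum. *)
Lemma tprod_vanishing_I0 (f : mpoly.mpoly #|{: idx}| R) :
  (forall u : forall i : 'I_d, 'I_(n i) -> R, peval (tprod u) f = 0) -> I0 f.
Proof.
have [s ->] := rpolyE f => f0.
have coef0 nu : \sum_(p <- s | marginal p.2 == nu) p.1 = 0.
  pose s' := [seq (p.1, marginal p.2) | p <- s].
  have := @monomials_independent R _ (index_enum coords) s' (index_enum_uniq _) _ nu.
  rewrite big_map /= => indep; rewrite -[RHS]indep => [|y]; last first.
    rewrite -[RHS](f0 (fun i (z : 'I_(n i)) => y (Tagged _ z))) big_map rmorph_sum /=.
    apply: eq_bigr => p _.
    rewrite pevalZ peval_mon_tprod; congr (_ * _); apply: eq_bigr => -[i c] _ //.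
  apply: eq_bigl => p; apply/eqP/allP => [-> //|eq_nu]; apply/ffunP => z.
  by apply/eqP/eq_nu; rewrite mem_index_enum.
(* One monomial is chosen per marginal; the default serves only those [nu] that are no marginal. *)
pose rep nu := xget [ffun=> 0%N] [set m | marginal m = nu].
have repP m : marginal (rep (marginal m)) = marginal m 
    by apply: (@xgetPex _ _ [set m0 | marginal m0 = marginal m]); exists m.
apply: (@ideal_cong _ _ I0_ideal _ (\sum_(p <- s) p.1 *: mon R (rep (marginal p.2)))).
  rewrite -sumrB; apply: (ideal_sum I0_ideal) => p _; rewrite -scalerBr.
  by apply: scaler_ideal; [exact: I0_ideal|exact: marginal_I0].
pose N := undup [seq marginal p.2 | p <- s].
have -> : \sum_(p <- s) p.1 *: mon R (rep (marginal p.2)) =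
    \sum_(p <- s) \sum_(nu <- N | marginal p.2 == nu) p.1 *: mon R (rep nu).
  apply: eq_big_seq => p ps; rewrite big_mkcond (bigD1_seq (marginal p.2)) ?undup_uniq //=.
    by rewrite eqxx big1 ?addr0 // => nu; rewrite eq_sym => /negPf->.
  by rewrite mem_undup; apply: (map_f (fun p => marginal p.2)).
rewrite (exchange_big_dep xpredT) //=; apply: (ideal_sum I0_ideal) => nu _.
rewrite -scaler_suml coef0 scale0r; exact: ideal0 I0_ideal.
Qed.

End SegreIdeal.

(** * Zero loci of generated ideals and of sums *)

Section ZeroLoci.
Variables (R : realType) (X : finType).
Local Notation rpoly := (mpoly.mpoly #|X| R).
Implicit Types (T : {ffun X -> R}) (G I J : set rpoly).

Lemma zero_locus_gen G T : zero_locus (ideal_gen G) T <-> forall g, G g -> peval T g = 0.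
Proof.
split=> [ZT g Gg|GT f [m [c [g [Gg ->]]]]]; first exact/ZT/sub_ideal_gen.
by rewrite rmorph_sum big1 // => j _; rewrite rmorphM /= (GT (g j)) ?mulr0.
Qed.

Lemma zero_locus_add I J T : is_ideal I -> is_ideal J ->
  zero_locus (ideal_add I J) T <-> zero_locus I T /\ zero_locus J T.
Proof.
move=> idI idJ; split=> [ZT|[IT JT] f [g [h [Ig Jh ->]]]].
  by split=> f If; apply: ZT; [exact: ideal_addl|exact: ideal_addr].
by rewrite rmorphD /= IT // JT // addr0.
Qed.

End ZeroLoci.

(** * The real points of [I0] and [I2] as rank-one tensors *)

Section RankOneTensors.
Variables (R : realType) (d : nat) (n : 'I_d -> nat).
Hypothesis d_gt0 : (0 < d)%N.
Local Notation idx := {dffun forall i : 'I_d, 'I_(n i)}.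
Local Notation tensor := {ffun idx -> R}.
Local Notation x := (@var R idx).
Local Notation I0 := (I0 R d n).
Local Notation I2 := (I2 R d n).
Local Notation factors := (forall i : 'I_d, 'I_(n i) -> R).
Implicit Types (a b : idx) (T : tensor) (u : factors).

Definition scale (s : R) T : tensor := [ffun a => s * T a].
Definition sqnorm T : R := \sum_a T a ^+ 2.
Definition unit_factors u : Prop := forall i, \sum_c u i c ^+ 2 = 1.

Lemma norm2_eq1 k (v : 'I_k -> R) : norm2 v = 1 <-> \sum_c v c ^+ 2 = 1.
Proof.
rewrite /norm2; split=> [v1|->]; last exact: sqrtr1.
by rewrite -[LHS]sqr_sqrtr ?v1 ?expr1n // sumr_ge0 // => c _; apply: sqr_ge0.
Qed.

Lemma zero_locus_I0 T : zero_locus I0 T <->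
  forall a b, T a * T b = T (idx_join a b) * T (idx_meet a b).
Proof.
split=> [ZT a b|ZT].
  by have := ZT _ (straighten R a b); rewrite rmorphB !rmorphM /= !peval_var => /subr0_eq.
apply/zero_locus_gen => _ [a [b [_ ->]]].
by rewrite rmorphB !rmorphM /= !peval_var ZT subrr.
Qed.

Lemma zero_locus_I2 T : zero_locus I2 T <-> zero_locus I0 T /\ sqnorm T = 1.
Proof.
rewrite zero_locus_add; [|exact: ideal_gen_ideal..].
have sphereE : peval T (sphere_poly R n) = sqnorm T - 1.
  rewrite rmorphB rmorph1 rmorph_sum; congr (_ - _).
  by apply: eq_bigr => a _; rewrite rmorphXn /= peval_var.
split=> [[/zero_locus_gen ZT ZT0]|[ZT T1]]; split=> //.
  by have /eqP := ZT _ erefl; rewrite sphereE subr_eq0 => /eqP.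
by apply/zero_locus_gen => _ ->; rewrite sphereE T1 subrr.
Qed.

Lemma scale_I0 s T : zero_locus I0 T -> zero_locus I0 (scale s T).
Proof.
move=> /zero_locus_I0 ZT; apply/zero_locus_I0 => a b.
by rewrite !ffunE mulrACA ZT [RHS]mulrACA.
Qed.

Lemma sqnorm_scale s T : sqnorm (scale s T) = s ^+ 2 * sqnorm T.
Proof. by rewrite /sqnorm mulr_sumr; apply: eq_bigr => a _; rewrite ffunE exprMn. Qed.

Lemma scaleN_I2 T : zero_locus I2 T -> zero_locus I2 (scale (-1) T).
Proof.
move=> /zero_locus_I2[ZT T1]; apply/zero_locus_I2; split; first exact: scale_I0.
by rewrite sqnorm_scale T1 sqrrN expr1n mulr1.
Qed.

Lemma tprod_I0 u : zero_locus I0 (tprod u).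
Proof.
apply/zero_locus_I0 => a b; rewrite !ffunE -!big_split /=; apply: eq_bigr => i _.
by rewrite !ffunE; case: leP => _ //; rewrite mulrC.
Qed.

Lemma tprod_scale (s : 'I_d -> R) u :
  tprod (fun i c => s i * u i c) = scale (\prod_i s i) (tprod u).
Proof. by apply/ffunP => a; rewrite !ffunE -big_split. Qed.

(** This is distributivity over dependent multi-indices; [fprod] turns these into choice functions
    into one tagged type. *)
Lemma sqnorm_tprod u : sqnorm (tprod u) = \prod_i \sum_c u i c ^+ 2.
Proof.
rewrite /sqnorm (reindex (@dffun_of_fprod _ (fun i => 'I_(n i)))) /=; last first.
  exact/onW_bij/dffun_of_fprod_bij.
pose F i : {ffun 'I_(n i) -> R} := [ffun c => u i c ^+ 2].
transitivity (\sum_(t : fprod (fun i => 'I_(n i))) \prod_i F i (t i)).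
  apply: eq_bigr => t _; rewrite ffunE -prodrXl; apply: eq_bigr => i _.
  by rewrite [RHS]ffunE /dffun_of_fprod ffunE.
have FE i : \sum_c u i c ^+ 2 =
    \sum_(z in tagged_with (fun i => 'I_(n i)) i) untag 0 (F i) z.
  transitivity (\sum_c F i c); first by apply: eq_bigr => c _; rewrite ffunE.
  exact: (big_tag (fun i => F i)).
under [RHS]eq_bigr do rewrite FE.
by rewrite big_fprod bigA_distr_big_dep.
Qed.

Lemma tprod_I2 u : unit_factors u -> zero_locus I2 (tprod u).
Proof.
move=> u1; apply/zero_locus_I2; split; first exact: tprod_I0.
by rewrite sqnorm_tprod big1.
Qed.

(** The coordinates of [a] are replaced by those of [b] in turn; by the swap relation against [a],
    replacing coordinate [i] multiplies the entry by [T (mix (pred1 i) b a) / T a]. *)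
Lemma rank1_pivot T a b : zero_locus I0 T -> T a != 0 ->
  T b = T a * \prod_i (T (mix (pred1 i) b a) / T a).
Proof.
move=> ZT Ta.
have swapT p (c e : idx) : T c * T e = T (mix p c e) * T (mix p e c).
  by have := ZT _ (swap_I0 R p c e); rewrite rmorphB !rmorphM /= !peval_var => /subr0_eq.
have mixT (l : seq 'I_d) : uniq l ->
    T (mix (mem l) b a) = T a * \prod_(i <- l) (T (mix (pred1 i) b a) / T a).
  elim: l => [_|j l IHl /= /andP[jNl /IHl IH]].
    by rewrite big_nil mulr1; congr (T _); apply/ffunP => i; rewrite ffunE.
  rewrite big_cons mulrCA -IH; apply: (mulIf Ta); rewrite mulrAC divfK //.
  rewrite (swapT (pred1 j)); congr (T _ * T _); apply/ffunP => i; rewrite !ffunE /= inE.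
    by case: eqP.
  by case: eqP => // ->; rewrite (negPf jNl).
rewrite -(mixT (index_enum _)) ?index_enum_uniq //; congr (T _); apply/ffunP => i.
by rewrite ffunE /= mem_index_enum.
Qed.

Lemma I2_tprod T : zero_locus I2 T -> exists2 u, unit_factors u & T = tprod u.
Proof.
move=> /zero_locus_I2[ZT T1].
have [a Ta] : exists a, T a != 0.
  apply/existsP; rewrite -negb_forall; apply/negP => /forallP T0.
  have := oner_neq0 R; rewrite -T1 /sqnorm big1 ?eqxx // => a _.
  by have /eqP-> := T0 a; rewrite expr0n.
(* [w i] is the fibre of [T] through the pivot [a] in direction [i], divided by [T a]. *)
pose w i (c : 'I_(n i)) := T (mix (pred1 i) [ffun j => dfwith a c j] a) / T a.
have TE : T = scale (T a) (tprod w).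
  apply/ffunP => b; rewrite (rank1_pivot b ZT Ta) !ffunE; congr (_ * _).
  apply: eq_bigr => i _; congr (T _ / _); apply/ffunP => j; rewrite !ffunE /=.
  by case: eqP => // ->; rewrite dfwith_in.
pose N i := \sum_c w i c ^+ 2.
have N_ge0 i : 0 <= N i by apply: sumr_ge0 => c _; apply: sqr_ge0.
have NT : T a ^+ 2 * \prod_i N i = 1 by rewrite -sqnorm_tprod -sqnorm_scale -TE.
have N_neq0 i : N i != 0.
  by apply/eqP => Ni; have := oner_neq0 R; rewrite -NT (bigD1 i) //= Ni mul0r mulr0 eqxx.
have rtN i : Num.sqrt (N i) != 0 by rewrite sqrtr_eq0 -ltNge lt_def N_neq0 N_ge0.
(* Normalizing all factors leaves this scalar, a sign because [sqnorm T] is 1; the first factor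
   absorbs it. *)
pose sg := T a * \prod_i Num.sqrt (N i).
have sg2 : sg ^+ 2 = 1.
  by rewrite exprMn -prodrXl -[RHS]NT; congr (_ * _); apply: eq_bigr => i _; rewrite sqr_sqrtr.
pose s i := (if i == Ordinal d_gt0 then sg else 1) / Num.sqrt (N i).
exists (fun i c => s i * w i c).
  move=> i; under eq_bigr do rewrite exprMn.
  rewrite -mulr_sumr -/(N i) /s exprMn exprVn sqr_sqrtr // mulfVK //.
  by case: eqP; rewrite ?sg2 ?expr1n.
rewrite tprod_scale {1}TE; congr (scale _ _).
rewrite /s big_split /= -big_mkcond /= big_pred1_eq /sg prodfV mulfK //.
by apply/prodf_neq0 => i _.
Qed.

Lemma vanishing_I0 : vanishing_ideal I0.
Proof. by move=> f f0; apply: (tprod_vanishing_I0 d_gt0) => u; exact/f0/tprod_I0. Qed.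

End RankOneTensors.

(** * Polynomials vanishing on the unit rank-one tensors *)

Section SphereIdeal.
Variables (R : realType) (d : nat) (n : 'I_d -> nat).
Hypotheses (d_gt0 : (0 < d)%N) (n_gt0 : forall i : 'I_d, (0 < n i)%N).
Local Notation idx := {dffun forall i : 'I_d, 'I_(n i)}.
Local Notation tensor := {ffun idx -> R}.
Local Notation x := (@var R idx).
Local Notation I0 := (I0 R d n).
Local Notation I2 := (I2 R d n).

Definition bot i : 'I_(n i) := Ordinal (n_gt0 i).

Lemma sum_delta k (c0 : 'I_k) : \sum_c ((c == c0)%:R : R) ^+ 2 = 1.
Proof.
by rewrite (bigD1 c0) //= eqxx big1 ?addr0 ?expr1n // => c /negPf->; rewrite expr0n.
Qed.

Lemma zero_locus_I2_nonempty : zero_locus I2 !=set0.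
Proof.
exists (tprod (fun i c => (c == bot i)%:R)); apply: tprod_I2 => // i.
exact: sum_delta.
Qed.

Lemma zero_locus_I0_cone (T : tensor) : zero_locus I0 T ->
  exists s v, zero_locus I2 v /\ T = scale s v.
Proof.
move=> ZT; have sq_ge0 a : 0 <= T a ^+ 2 by exact: sqr_ge0.
have [T0|T_neq0] := eqVneq (sqnorm T) 0.
  have [v Zv] := zero_locus_I2_nonempty; exists 0, v; split=> //.
  apply/ffunP => a; rewrite ffunE mul0r; apply/eqP; rewrite -sqrf_eq0.
  by move/eqP: T0; rewrite psumr_eq0 // => /allP/(_ a (mem_index_enum _)).
have T_gt0 : 0 < sqnorm T by rewrite lt_def T_neq0 sumr_ge0.
have rt0 : Num.sqrt (sqnorm T) != 0 by rewrite sqrtr_eq0 -ltNge.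
exists (Num.sqrt (sqnorm T)), (scale (Num.sqrt (sqnorm T))^-1 T); split.
  apply/zero_locus_I2; split; first exact: scale_I0.
  by rewrite sqnorm_scale exprVn sqr_sqrtr ?mulVf // ltW.
by apply/ffunP => a; rewrite !ffunE mulrA divff // mul1r.
Qed.

Definition mdeg (m : {ffun idx -> nat}) : nat := (\sum_a m a)%N.

Lemma peval_mon_scale s (v : tensor) m :
  peval (scale s v) (mon R m) = s ^+ mdeg m * peval v (mon R m).
Proof.
rewrite !peval_mon -prodrXr -big_split /=; apply: eq_bigr => a _.
by rewrite ffunE exprMn.
Qed.

Lemma I2_ideal : is_ideal I2.
Proof. by apply: ideal_add_ideal; exact: ideal_gen_ideal. Qed.

(* [V(I2)] is symmetric, so the even and the odd part of [f] vanish on it; made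
   homogeneous by powers of [S], both vanish on the cone [V(I0)]. *)
Lemma vanishing_I2 : vanishing_ideal I2.
Proof.
move=> f; have [s ->] := rpolyE f => f0.
pose S : mpoly.mpoly #|{: idx}| R := \sum_a x a ^+ 2.
pose D := (\max_(p <- s) mdeg p.2)%N.
have degD p : p \in s -> ((mdeg p.2)./2 <= D)%N.
  move=> ps; apply: leq_trans (half_leq (leqnn _)) _.
  apply: leq_trans (@leq_bigmax_seq _ s xpredT (fun p => mdeg p.2) p ps isT).
  by rewrite -{2}[mdeg p.2]odd_double_half -addnn addnA leq_addl.
(* A degree of parity [b] is [b] plus twice its half, so every term of [F b] has degree
   [b + D.*2]. *)
pose F b := \sum_(p <- s | odd (mdeg p.2) == b) p.1 *: (mon R p.2 * S ^+ (D - (mdeg p.2)./2)).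
pose A (v : tensor) b := \sum_(p <- s | odd (mdeg p.2) == b) p.1 * peval v (mon R p.2).
have A0 v b : zero_locus I2 v -> A v b = 0.
  move=> Zv; have split_parity (G : R * {ffun idx -> nat} -> R) :
      \sum_(p <- s) G p = \sum_(p <- s | odd (mdeg p.2) == true) G p +
                          \sum_(p <- s | odd (mdeg p.2) == false) G p.
    by rewrite (bigID (fun p => odd (mdeg p.2) == true)) /=; congr (_ + _);
      apply: eq_bigl => p; case: odd.
  (* The values at [v] and at its opposite are the sum and, up to sign, the difference of the two
     parity parts. *)
  have Av : A v true + A v false = 0.
    rewrite -split_parity -[RHS](f0 v Zv) rmorph_sum /=; apply: eq_bigr => p _.
    by rewrite pevalZ.
  have ANv : - A v true + A v false = 0.
    rewrite -[RHS](f0 _ (scaleN_I2 Zv)) rmorph_sum /= [RHS]split_parity -sumrN; congr (_ + _).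
      apply: eq_bigr => p /eqP odd_p.
      by rewrite pevalZ peval_mon_scale -signr_odd odd_p expr1 mulN1r mulrN.
    apply: eq_bigr => p /eqP odd_p.
    by rewrite pevalZ peval_mon_scale -signr_odd odd_p expr0 mul1r.
  by case: b; lra.
have FI0 b : I0 (F b).
  apply: vanishing_I0 => // T /zero_locus_I0_cone[r [v [Zv ->]]].
  transitivity (r ^+ (b + D.*2) * A v b); last by rewrite A0 ?mulr0.
  have SE : peval (scale r v) S = r ^+ 2.
    have /zero_locus_I2[_ v1] := Zv.
    rewrite -[RHS]mulr1 -v1 -sqnorm_scale rmorph_sum; apply: eq_bigr => a _.
    by rewrite rmorphXn /= peval_var.
  rewrite rmorph_sum mulr_sumr /= big_seq_cond [RHS]big_seq_cond; apply: eq_bigr => p.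
  case/andP=> /degD leD /eqP <-.
  rewrite pevalZ rmorphM rmorphXn /= SE peval_mon_scale [RHS]mulrCA; congr (_ * _).
  rewrite mulrAC -exprM -exprD; congr (r ^+ _ * _).
  by rewrite -{1}[mdeg p.2]odd_double_half -addnA mul2n -doubleD subnKC.
have FI2 b : I2 (F b) by apply: ideal_addr => //; exact: ideal_gen_ideal.
apply: (@ideal_cong _ _ I2_ideal _ (F true + F false)); last exact: idealD I2_ideal _ _ _ _.
apply: ideal_addl; first exact: ideal_gen_ideal.
have -> : F true + F false = \sum_(p <- s) p.1 *: (mon R p.2 * S ^+ (D - (mdeg p.2)./2)).
  rewrite [RHS](bigID (fun p => odd (mdeg p.2) == true)) /=; congr (_ + _).
  by apply: eq_bigl => p; case: odd.
rewrite -sumrB; apply: ideal_sum => [|p _]; first exact: ideal_gen_ideal.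
rewrite -scalerBr; apply: scaler_ideal; first exact: ideal_gen_ideal.
(* The homogenizing factor [S ^+ k] differs from 1 by a multiple of [S - 1], the sphere
   polynomial. *)
rewrite -[X in X - _]mulr1 -mulrBr -opprB mulrN -mulNr subrX1 mulrCA mulrC.
by apply: (idealMl (ideal_gen_ideal _)); apply: sub_ideal_gen.
Qed.

End SphereIdeal.

(** * The ideals with finitely many real points *)

Section FiniteVarieties.
Variables (R : realType) (d : nat) (n : 'I_d -> nat).

Lemma real_radical_I1 : is_real_radical (I1 R d n).
Proof.
apply: vanishing_real_radical; apply: vanishing_finite => [|a]; first exact: ideal_gen_ideal.
by apply: sub_ideal_gen; left; right; exists a.
Qed.

Lemma real_radical_Iinfty : is_real_radical (Iinfty R d n).
Proof.
apply: vanishing_real_radical; apply: vanishing_finite => [|a].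
  by apply: ideal_add_ideal; exact: ideal_gen_ideal.
apply: ideal_addl; first exact: ideal_gen_ideal.
rewrite exprS -[X in _ - X]mulr1 -mulrBr.
by apply: (idealMl (ideal_gen_ideal _)); apply: sub_ideal_gen; exists a.
Qed.

End FiniteVarieties.

(** * Rational parametrization of spheres by reflections *)

(* [|y| ^ 2] times the mirror image of the basis vector [e_c0] in the hyperplane
   orthogonal to [y]; over the nonzero [y] in dimension at least 2, its direction
   takes all values on the unit sphere. *)
Definition mirror (P : comNzRingType) (k : nat) (c0 : 'I_k) (y : 'I_k -> P) (c : 'I_k) : P :=
  (\sum_e y e ^+ 2) * (c == c0)%:R - 2 * y c0 * y c.

Lemma sum_deltaM (P : comNzRingType) (k : nat) (c0 : 'I_k) (y : 'I_k -> P) :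
  \sum_c (c == c0)%:R * y c = y c0.
Proof. by rewrite (bigD1 c0) //= eqxx mul1r big1 ?addr0 // => c /negPf->; rewrite mul0r. Qed.

(** Reflections are isometries, and [mirror] carries the extra factor [|y| ^ 2]. *)
Lemma sum_mirror_sqr (P : comNzRingType) (k : nat) (c0 : 'I_k) (y : 'I_k -> P) :
  \sum_c mirror c0 y c ^+ 2 = (\sum_c y c ^+ 2) ^+ 2.
Proof.
rewrite /mirror; pose N := \sum_e y e ^+ 2; rewrite -/N.
transitivity (\sum_c ((c == c0)%:R * N ^+ 2 - (c == c0)%:R * (4 * N * y c0 * y c)
                      + 4 * y c0 ^+ 2 * y c ^+ 2)).
  by apply: eq_bigr => c _; case: (c == c0); rewrite ?mulr1n ?mulr0n; ring.
rewrite big_split sumrB /= (sum_deltaM c0 (fun=> N ^+ 2)).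
by rewrite (sum_deltaM c0 (fun c => 4 * N * y c0 * y c)) -mulr_sumr -/N; ring.
Qed.

Lemma horner_mirror (R : realType) (k : nat) (c0 : 'I_k) (y : 'I_k -> {poly R}) (c : 'I_k) t :
  (mirror c0 y c).[t] = mirror c0 (fun e => (y e).[t]) c.
Proof.
rewrite /mirror !hornerE horner_sum; congr (_ * _ - _ * _ * _).
- by apply: eq_bigr => e _; rewrite horner_exp.
- by case: (c == c0); rewrite ?hornerE.
Qed.

(** Reflection along [e_c0 - u] exchanges [e_c0] and [u]. If [u = e_c0] this direction is zero and a
    basis vector orthogonal to [e_c0] is used instead, which takes a second dimension. *)
Lemma mirror_surj (R : realType) (k : nat) (c0 : 'I_k) (u : 'I_k -> R) :
  \sum_c u c ^+ 2 = 1 -> (1 < k)%N \/ u c0 != 1 ->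
  exists y, \sum_c y c ^+ 2 != 0 /\ forall c, mirror c0 y c = (\sum_c y c ^+ 2) * u c.
Proof.
move=> u1 k_gt1; pose y c := (c == c0)%:R - u c.
have yE : \sum_c y c ^+ 2 = 2 - 2 * u c0.
  transitivity (\sum_c ((c == c0)%:R * (1 - 2 * u c) + u c ^+ 2)).
    by apply: eq_bigr => c _; rewrite /y; case: (c == c0) => /=; ring.
  by rewrite big_split /= u1 (sum_deltaM c0 (fun c => 1 - 2 * u c)); ring.
have [u01|u01] := eqVneq (u c0) 1; last first.
  exists y; split; first by rewrite yE; apply: contra u01 => /eqP ?; apply/eqP; lra.
  by move=> c; rewrite /mirror yE /y eqxx /=; ring.
have {}k_gt1 : (1 < k)%N by case: k_gt1; rewrite // u01 eqxx.
have uE c : u c = (c == c0)%:R.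
  have /eqP : \sum_c y c ^+ 2 = 0 by rewrite yE u01; ring.
  rewrite psumr_eq0 => [/allP/(_ c (mem_index_enum _))|? _]; last exact: sqr_ge0.
  by rewrite sqrf_eq0 subr_eq0 => /eqP.
have [c1 c10] : exists c1 : 'I_k, c1 != c0.
  have [c00|c00] := eqVneq (val c0) 0%N.
    by exists (Ordinal k_gt1); rewrite -val_eqE /= c00.
  by exists (Ordinal (ltnW k_gt1)); rewrite -val_eqE /= eq_sym.
exists (fun c => (c == c1)%:R); rewrite sum_delta; split; first exact: oner_neq0.
by move=> c; rewrite /mirror sum_delta [c0 == c1]eq_sym (negPf c10) uE /=; ring.
Qed.

(** A high enough power of the common denominator [N] clears all denominators of [f] along the curve
    [T / N]. *)
Lemma rational_curve (R : realType) (X : finType) (f : mpoly.mpoly #|X| R)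
    (T : X -> {poly R}) (N : {poly R}) :
  exists (p : {poly R}) (K : nat), forall t, N.[t] != 0 ->
    p.[t] = N.[t] ^+ K * peval [ffun a => (T a).[t] / N.[t]] f.
Proof.
elim/rpoly_ind: f => [c|f g [p [K pE]] [q [L qE]]|f a [p [K pE]]].
- exists c%:P, 0%N => t _; by rewrite hornerC pevalZ rmorph1 expr0 mul1r mulr1.
- exists (p * N ^+ L + q * N ^+ K), (K + L)%N => t Nt.
  by rewrite !hornerE /= pE // qE // rmorphD /= exprD; ring.
- exists (T a * p), K.+1 => t Nt.
  by rewrite hornerM pE // rmorphM /= peval_var ffunE exprS; field.
Qed.

(** * Primality and irreducibility through rational curves *)

Section Primality.
Variables (R : realType) (d : nat) (n : 'I_d -> nat).
Hypotheses (d_gt0 : (0 < d)%N) (n_gt0 : forall i : 'I_d, (0 < n i)%N).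
Variable j : 'I_d.
Hypothesis nj_gt1 : (1 < n j)%N.
Local Notation idx := {dffun forall i : 'I_d, 'I_(n i)}.
Local Notation tensor := {ffun idx -> R}.
Local Notation I2 := (I2 R d n).
Local Notation factors := (forall i : 'I_d, 'I_(n i) -> R).
Local Notation bot := (bot n_gt0).
Implicit Types (y : factors) (f g : mpoly.mpoly #|{: idx}| R).

Definition sqnorms y : R := \prod_i \sum_c y i c ^+ 2.

(** The product of the reflected unit vectors, written over one denominator to fit
    [rational_curve]. *)
Definition mirror_tensor y : tensor :=
  [ffun a : idx => (\prod_i mirror (bot i) (y i) (a i)) / sqnorms y].

Lemma mirror_tensor_I2 y : sqnorms y != 0 -> zero_locus I2 (mirror_tensor y).
Proof.
move=> /prodf_neq0 y0.
have -> : mirror_tensor y = tprod (fun i c => mirror (bot i) (y i) c / \sum_c y i c ^+ 2).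
  by apply/ffunP => a; rewrite !ffunE big_split /= prodfV.
apply: tprod_I2 => // i; under eq_bigr do rewrite exprMn.
by rewrite -mulr_suml sum_mirror_sqr exprVn mulfV // expf_neq0 // y0.
Qed.

(* For [n i = 1] the mirror only yields the value -1, the sign is moved to [j]. *)
Lemma mirror_tensor_surj v : zero_locus I2 v ->
  exists2 y, sqnorms y != 0 & v = mirror_tensor y.
Proof.
move=> /(I2_tprod d_gt0)[u u1 ->].
have u_sign i : n i == 1%N -> u i (bot i) ^+ 2 = 1.
  move=> /eqP ni; rewrite -(u1 i) (bigD1 (bot i)) //= big1 ?addr0 // => c /eqP[].
  by apply: val_inj => /=; have := ltn_ord c; rewrite {2}ni ltnS leqn0 => /eqP.
pose Q := \prod_(i | n i == 1%N) - u i (bot i).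
have Q2 : Q ^+ 2 = 1 by rewrite -prodrXl big1 // => i /u_sign; rewrite sqrrN.
(* These signs turn every one-entry factor into -1; [Q] at [j] makes their product 1, so the tensor
   is unchanged. *)
pose s i := if n i == 1%N then - u i (bot i) else if i == j then Q else 1.
have s2 i : s i ^+ 2 = 1.
  by rewrite /s; case: ifP => [/u_sign|_]; [rewrite sqrrN|case: eqP; rewrite ?expr1n].
have prod_s : \prod_i s i = 1.
  rewrite (bigID (fun i => n i == 1%N)) /= -[RHS]Q2 expr2; congr (_ * _).
    by apply: eq_bigr => i ni; rewrite /s ni.
  rewrite (bigD1 j) ?gtn_eqF //= /s gtn_eqF // eqxx big1 ?mulr1 // => i /andP[/negPf-> /negPf->].
  by [].
have su1 i : \sum_c (s i * u i c) ^+ 2 = 1.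
  by under eq_bigr do rewrite exprMn s2 mul1r; exact: u1.
have /= H i : exists yi, \sum_c yi c ^+ 2 != 0 /\
    forall c, mirror (bot i) yi c = (\sum_c yi c ^+ 2) * (s i * u i c).
  apply: mirror_surj => //; rewrite /s; have [ni|] := eqVneq (n i) 1%N.
    right; rewrite mulNr -expr2 u_sign ?ni // eq_sym -subr_eq0 opprK.
    by rewrite -(natrD _ 1 1) pnatr_eq0.
  by move=> ni; left; rewrite ltn_neqAle eq_sym ni n_gt0.
pose y i := projT1 (cid (H i)).
have yP i : \sum_c y i c ^+ 2 != 0 /\
    forall c, mirror (bot i) (y i) c = (\sum_c y i c ^+ 2) * (s i * u i c).
  exact: projT2 (cid (H i)).
have y0 : sqnorms y != 0 by apply/prodf_neq0 => i _; case: (yP i).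
exists y => //; apply/ffunP => a; rewrite !ffunE.
under [in RHS]eq_bigr => i _ do rewrite (proj2 (yP i)).
by rewrite !big_split /= prod_s mul1r mulrAC divff // mul1r.
Qed.

(* Two points of [V(I2)] lie on a rational curve in [V(I2)]: the image of a line
   under [mirror_tensor]. *)
Lemma vanishing_prime f g :
  (forall T, zero_locus I2 T -> peval T f * peval T g = 0) ->
  (forall T, zero_locus I2 T -> peval T f = 0) \/
  (forall T, zero_locus I2 T -> peval T g = 0).
Proof.
move=> fg0; have [|/existsNP[p /not_implyP[Zp /eqP fp]]] :=
  pselect (forall T, zero_locus I2 T -> peval T f = 0); first by left.
right=> q Zq; apply/eqP/negP => /negP gq.
have [y y0 pE] := mirror_tensor_surj Zp; have [z z0 qE] := mirror_tensor_surj Zq.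
(* The line from [y] at parameter 0 to [z] at parameter 1. *)
pose L i c : {poly R} := (y i c)%:P + 'X * (z i c - y i c)%:P.
pose M a : {poly R} := \prod_i mirror (bot i) (L i) ((a : idx) i).
pose N : {poly R} := \prod_i \sum_c L i c ^+ 2.
pose Lt t i c := (L i c).[t].
have NE t : N.[t] = sqnorms (Lt t).
  rewrite /N horner_prod; apply: eq_bigr => i _; rewrite horner_sum.
  by apply: eq_bigr => c _; rewrite horner_exp.
have ME t : [ffun a => (M a).[t] / N.[t]] = mirror_tensor (Lt t).
  apply/ffunP => a; rewrite !ffunE NE /M horner_prod; congr (_ / _).
  by apply: eq_bigr => i _; rewrite horner_mirror.
have L0 : Lt 0 = y.
  by apply: functional_extensionality_dep => i; apply/funext => c; rewrite /Lt /L !hornerE.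
have L1 : Lt 1 = z.
  apply: functional_extensionality_dep => i; apply/funext => c.
  by rewrite /Lt /L !hornerE /=; ring.
have [P [K PE]] := rational_curve f M N; have [Q [K' QE]] := rational_curve g M N.
have N0 : N.[0] != 0 by rewrite NE L0.
have N1 : N.[1] != 0 by rewrite NE L1.
have P0 : P.[0] != 0 by rewrite PE // ME L0 -pE mulf_neq0 // expf_neq0.
have Q1 : Q.[1] != 0 by rewrite QE // ME L1 -qE mulf_neq0 // expf_neq0.
(* The factor [N] covers the parameters where the curve is undefined. One of the three factors must
   be zero, but [N] and [P] are nonzero at 0 and [Q] at 1. *)
have : N * (P * Q) = 0.
  apply: poly_vanishing_eq0 => t; rewrite !hornerM.
  have [->|Nt] := eqVneq N.[t] 0; first by rewrite mul0r.
  rewrite PE // QE // ME mulrACA fg0 ?mulr0 //; apply: mirror_tensor_I2; by rewrite -NE.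
move=> /eqP; rewrite !mulf_eq0 => /or3P[] /eqP eq0.
- by rewrite eq0 horner0 eqxx in N0.
- by rewrite eq0 horner0 eqxx in P0.
- by rewrite eq0 horner0 eqxx in Q1.
Qed.

Lemma zero_locusP f : (forall T, zero_locus I2 T -> peval T f = 0) <-> I2 f.
Proof. by split=> [|fI2 T]; [exact: vanishing_I2|exact]. Qed.

Lemma prime_I2 : is_prime_ideal I2.
Proof.
split; first split.
- by rewrite !inE; exact: ideal0 (I2_ideal R n).
- have [T ZT] := zero_locus_I2_nonempty R n_gt0.
  by apply/negP; rewrite !inE => /ZT /eqP; rewrite rmorph1 oner_eq0.
- move=> a f g; rewrite !inE => fI gI.
  by apply: (idealD (I2_ideal R n)) => //; apply: (idealMl (I2_ideal R n)).
- move=> f g; rewrite !inE => /zero_locusP fg0.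
  apply/orP; have [T /fg0|/zero_locusP f0|/zero_locusP g0] := @vanishing_prime f g.
  + by rewrite rmorphM.
  + by left; apply/mem_set.
  + by right; apply/mem_set.
Qed.

Lemma irreducible_I2 : zariski_irreducible (zero_locus I2).
Proof.
split; first exact: zero_locus_I2_nonempty.
move=> A B [F ->] [G ->] ZFG.
have [|/existsNP[p /not_implyP[Zp /existsNP[f /not_implyP[Ff /eqP fp]]]]] :=
  pselect (zero_locus I2 `<=` zero_locus F); first by left.
right=> q Zq g Gg; have [T ZT|f0|g0] := @vanishing_prime f g.
- by case: (ZFG T ZT) => [/(_ _ Ff)|/(_ _ Gg)] ->; rewrite ?mul0r ?mulr0.
- by rewrite f0 ?eqxx in fp.
- exact: g0.
Qed.

End Primality.

(** * Limits of bounded sets under polynomial inequalities *)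

Section PolynomialCompactness.
Import ArrowAsProduct.
Variables (R : realType) (I : finType).
Implicit Types (C : R -> set {ffun I -> R}) (q : mpoly.mpoly #|I| R).

Lemma peval_continuous q : continuous (fun g : I -> R => peval [ffun i => g i] q).
Proof.
pose ev q (g : I -> R) := peval [ffun i => g i] q; rewrite -/(ev q).
elim/rpoly_ind: q => [c|p q pc qc|p i pc] g.
- have -> : ev c%:A = fun=> c by apply/funext => h; rewrite /ev pevalZ rmorph1 mulr1.
  exact: cst_continuous.
- have -> : ev (p + q) = fun h => ev p h + ev q h by apply/funext => h; rewrite /ev rmorphD.
  exact: cvgD (pc g) (qc g).
- have -> : ev (var R i * p) = fun h => h i * ev p h.
    by apply/funext => h; rewrite /ev rmorphM /= peval_var ffunE.
  by apply: cvgM (pc g); exact: (@proj_continuous I (fun=> R) i g).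
Qed.

(** The point is a cluster point of the sets [C e] as [e] tends to 0; it exists by Tychonoff in a
    product of segments. Polynomial inequalities are closed conditions, so it inherits those valid
    on any [C e]. *)
Lemma polynomial_compactness C B :
  (forall e, 0 < e -> C e !=set0) -> (forall e e', e <= e' -> C e `<=` C e') ->
  (forall g, C 1 g -> forall i, - B <= g i <= B) ->
  exists g, forall q e, 0 < e -> (forall h, C e h -> 0 <= peval h q) -> 0 <= peval g q.
Proof.
move=> C0 Cmono CB.
pose F : set_system (I -> R) :=
  filter_from [set e : R | 0 < e] (fun e => [set g | C e [ffun i => g i]]).
have FF : ProperFilter F.
  apply: filter_from_proper => [|e /C0[g Cg]]; last first.
    by exists g; rewrite /= (_ : [ffun i => g i] = g) //; apply/ffunP => i; rewrite ffunE.
  apply: filter_from_filter => [|e e' e_gt0 e'_gt0]; first by exists 1; exact: ltr01.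
  exists (Num.min e e'); first by rewrite /= lt_min e_gt0.
  by move=> g Cg; split; apply: (Cmono (Num.min e e')) => //; rewrite ge_min lexx ?orbT.
have FB : F [set g | forall i, `[- B, B] (g i)].
  by exists 1; [exact: ltr01|move=> g /CB gB i; have := gB i; rewrite ffunE /= in_itv].
have [g [_]] := @tychonoff I (fun=> R) (fun=> `[- B, B]) (fun=> @segment_compact R _ _) F FF FB.
rewrite clusterE => Fg; exists [ffun i => g i] => q e e_gt0 Cq.
pose A := [set h : I -> R | 0 <= peval [ffun i => h i] q].
have cA : closed A.
  apply: (@preimage_closed _ _ (fun h : I -> R => peval [ffun i => h i] q) [set t | 0 <= t]).
    by move=> h _; exact: peval_continuous.
  exact: closed_ge.
by apply: cA; apply: Fg; exists e => // h /Cq.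
Qed.

End PolynomialCompactness.

(** * Caratheodory reduction with control of the cost *)

Section ConicCombinations.
Variables (R : realType) (X : finType) (A : set {ffun X -> R}).
Implicit Types (T w : {ffun X -> R}).

Definition conic (m : nat) (s : R) T : Prop :=
  exists (lam : 'I_m -> R) (v : 'I_m -> {ffun X -> R}),
    [/\ forall j, 0 <= lam j, forall j, A (v j), forall a, T a = \sum_j lam j * v j a
      & \sum_j lam j = s].

Lemma conic_cons m s c w T : 0 <= c -> A w -> conic m s T ->
  conic m.+1 (c + s) [ffun a => c * w a + T a].
Proof.
move=> c0 Aw [lam [v [lam0 Av TE <-]]].
exists (fun i => oapp lam c (unlift ord0 i)), (fun i => oapp v w (unlift ord0 i)); split.
- by move=> i; case: (unlift _ i).
- by move=> i; case: (unlift _ i).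
- move=> a; rewrite ffunE big_ord_recl unlift_none TE /=; congr (_ + _).
  by apply: eq_bigr => j _; rewrite liftK.
- rewrite big_ord_recl unlift_none /=; congr (_ + _).
  by apply: eq_bigr => j _; rewrite liftK.
Qed.

Lemma conic_pad m k s w T : A w -> (m <= k)%N -> conic m s T -> conic k s T.
Proof.
move=> Aw /subnK <-; elim: (k - m)%N => [//|r IHr] /IHr /(conic_cons (lexx 0) Aw).
rewrite add0r addSn; congr (conic _ _ _); apply/ffunP => a.
by rewrite ffunE mul0r add0r.
Qed.

(** More vectors than coordinates are dependent. Up to sign the relation has nonnegative sum, and
    being nonzero it then has a positive entry. *)
Lemma dependency_pos (m : nat) (v : 'I_m -> {ffun X -> R}) : (#|X| < m)%N ->
  exists mu : 'I_m -> R, [/\ forall a, \sum_j mu j * v j a = 0, 0 <= \sum_j mu j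
    & exists j, 0 < mu j].
Proof.
move=> lt_m; pose M : 'M[R]_(m, #|X|) := \matrix_(j, k) v j (enum_val k).
have : kermx M != 0.
  by rewrite kermx_eq0 /row_free neq_ltn (leq_ltn_trans (rank_leq_col M)).
case/rowV0Pn => mu /sub_kermxP muM mu0.
have dep a : \sum_j mu 0 j * v j a = 0.
  have /matrixP/(_ 0 (enum_rank a)) := muM; rewrite !mxE => muMa; rewrite -[RHS]muMa.
  by apply: eq_bigr => j _; rewrite mxE enum_rankK.
have pos (nu : 'I_m -> R) : 0 <= \sum_j nu j -> (exists j, nu j != 0) -> exists j, 0 < nu j.
  move=> nu_ge0 [j nuj]; apply/existsP; rewrite -[X in is_true X]negbK negb_exists.
  apply/negP => /forallP nu_le0; have {}nu_le0 k : 0 <= - nu k by rewrite oppr_ge0 leNgt nu_le0.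
  have : \sum_k - nu k == 0.
    by rewrite eq_le sumr_ge0 // sumrN oppr_le0 nu_ge0.
  rewrite psumr_eq0 // => /allP/(_ j (mem_index_enum _)) /=.
  by rewrite oppr_eq0 (negPf nuj).
have [j muj] : exists j, mu 0 j != 0.
  by have /rV0Pn := mu0.
have [ge0|/ltW le0] := leP 0 (\sum_j mu 0 j).
  by exists (mu 0); split=> //; apply: pos => //; exists j.
exists (fun j => - mu 0 j); split.
- by move=> a; under eq_bigr do rewrite mulNr; rewrite sumrN dep oppr0.
- by rewrite sumrN oppr_ge0.
- by apply: pos; [rewrite sumrN oppr_ge0|exists j; rewrite oppr_eq0].
Qed.

(** Subtracting from the weights [t] times a dependency [mu], with [t] the least ratio [lam / mu]
    over positive [mu], kills one weight and keeps the others nonnegative. The cost does not grow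
    because [mu] has nonnegative sum. *)
Lemma conic_caratheodory m s w T : A w -> conic m s T ->
  exists2 s', s' <= s & conic #|X| s' T.
Proof.
move=> Aw; elim: m s => [|m IHm] s conicT.
  by exists s => //; apply: conic_pad Aw _ conicT.
have [le_m|lt_m] := leqP m.+1 #|X|; first by exists s => //; apply: conic_pad Aw _ conicT.
have [lam [v [lam0 Av TE <-]]] := conicT.
have [mu [dep mu_ge0 [j0 muj0]]] := dependency_pos v lt_m.
case: (@Order.TotalTheory.arg_minP _ _ _ j0 (fun j => 0 < mu j) (fun j => lam j / mu j) muj0).
move=> j muj minj; pose t := lam j / mu j.
have t0 : 0 <= t by rewrite divr_ge0 // ltW.
pose lam' k := lam k - t * mu k.
have lam'0 k : 0 <= lam' k.
  rewrite subr_ge0; have [muk|muk] := ltP 0 (mu k); first by rewrite -ler_pdivlMr // minj.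
  by apply: le_trans (lam0 k); rewrite mulr_ge0_le0.
have lam'j : lam' j = 0 by rewrite /lam' divfK ?subrr // gt_eqF.
have [|s' s's conicT'] := IHm (\sum_k lam' k).
  exists (fun k => lam' (lift j k)), (fun k => v (lift j k)); split=> // [a|].
    transitivity (\sum_k lam' k * v k a); last by rewrite (bigD1_ord j) //= lam'j mul0r add0r.
    under eq_bigr do rewrite mulrBl -mulrA.
    by rewrite sumrB -mulr_sumr dep mulr0 subr0.
  by rewrite [RHS](bigD1_ord j) //= lam'j add0r.
exists s' => //; apply: (le_trans s's).
by rewrite sumrB -mulr_sumr lerBlDr lerDl mulr_ge0.
Qed.

End ConicCombinations.

(** * Attainment of the nuclear norm and the unit ball *)

Section NuclearBall.
Variables (R : realType) (d : nat) (n : 'I_d -> nat).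
Hypotheses (d_gt0 : (0 < d)%N) (n_gt0 : forall i : 'I_d, (0 < n i)%N).
Local Notation idx := {dffun forall i : 'I_d, 'I_(n i)}.
Local Notation tensor := {ffun idx -> R}.
Local Notation I2 := (I2 R d n).
Local Notation V := (zero_locus I2).
Implicit Types (T : tensor).

Definition nuclear_costs T : set R :=
  [set s | exists (m : nat) (lam : 'I_m -> R) (u : 'I_m -> forall i : 'I_d, 'I_(n i) -> R),
     [/\ forall j i, norm2 (u j i) = 1, T = [ffun a => \sum_(j < m) lam j * tprod (u j) a]
       & s = \sum_(j < m) `|lam j|]].

(** The signs of the coefficients move into the tensors, as [V] is symmetric. *)
Lemma nuclear_costsP T s : nuclear_costs T s <-> exists m, conic V m s T.
Proof.
split=> [[m [lam [u [u1 -> ->]]]]|[m [lam [v [lam0 Vv TE <-]]]]]; exists m.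
  pose sg j : R := if 0 <= lam j then 1 else -1.
  exists (fun j => `|lam j|), (fun j => scale (sg j) (tprod (u j))); split=> // [j|a].
    have Vu : V (tprod (u j)) by apply: tprod_I2 => // i; apply/norm2_eq1.
    rewrite /sg; case: ifP => _; last exact: scaleN_I2.
    by rewrite (_ : scale 1 _ = tprod (u j)) //; apply/ffunP => a; rewrite ffunE mul1r.
  rewrite ffunE; apply: eq_bigr => j _; rewrite [in RHS]ffunE mulrA /sg; congr (_ * _).
  have [ge0|lt0] := leP 0 (lam j); first by rewrite ger0_norm ?mulr1.
  by rewrite ltr0_norm // mulrN1 opprK.
have H j : {u | unit_factors u & v j = tprod u} by apply/cid2/(I2_tprod d_gt0)/Vv.
exists lam, (fun j => s2val (H j)); split=> [j i||].
- by apply/norm2_eq1; exact: (s2valP (H j)).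
- apply/ffunP => a; rewrite TE ffunE; apply: eq_bigr => j _.
  by rewrite {1}(s2valP' (H j)).
- by apply: eq_bigr => j _; rewrite ger0_norm.
Qed.

(** The expansion of [T] in products of standard basis vectors is a decomposition. *)
Lemma nuclear_costs_nonempty T : nuclear_costs T !=set0.
Proof.
eexists; exists #|{: idx}|, (fun j => T (enum_val j)),
  (fun j i c => (c == (enum_val j : idx) i)%:R); split; last reflexivity.
  by move=> j i; apply/norm2_eq1; exact: sum_delta.
apply/ffunP => a; rewrite ffunE; transitivity (\sum_b T b * \prod_i (a i == (b : idx) i)%:R).
  rewrite (bigD1 a) //= [X in _ + X]big1 => [|b ba].
    by rewrite addr0 big1 ?mulr1 // => i _; rewrite eqxx.
  have [i /negPf abi] : exists i, a i != b i.
    apply/existsP; rewrite -negb_forall; apply: contra ba => /forallP ab.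
    by apply/eqP/ffunP => i; rewrite (eqP (ab i)).
  by rewrite (bigD1 i) //= abi mul0r mulr0.
rewrite (reindex (@enum_val _ {: idx})) /=; last exact/onW_bij/enum_val_bij.
by apply: eq_bigr => j _; rewrite ffunE.
Qed.

Lemma nuclear_costs_ge0 T s : nuclear_costs T s -> 0 <= s.
Proof. by move=> [m [lam [u [_ _ ->]]]]; apply: sumr_ge0. Qed.

Lemma nuclear_costs_has_inf T : has_inf (nuclear_costs T).
Proof.
by split; [exact: nuclear_costs_nonempty|exists 0 => s; exact: nuclear_costs_ge0].
Qed.

Lemma nuclear_norm_attained T : nuclear_norm T <= 1 ->
  exists m s, s <= 1 /\ conic V m s T.
Proof.
move=> T1; have [v0 Vv0] := zero_locus_I2_nonempty R n_gt0.
pose N := #|{: idx}|.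
(* A point of [C e] encodes an [N]-term decomposition of [T] of cost at most [1 + e]: the weights
   sit at [(j, None)], the entries of the tensors at [(j, Some a)]. *)
pose C e : set {ffun 'I_N * option idx -> R} := [set g |
  [/\ forall j, 0 <= g (j, None), forall j, V [ffun a => g (j, Some a)],
      forall a, T a = \sum_j g (j, None) * g (j, Some a) & \sum_j g (j, None) <= 1 + e]].
have C0 e : 0 < e -> C e !=set0.
  move=> e0; have [s Ts lts] := inf_adherent e0 (nuclear_costs_has_inf T).
  have [m conicT] := (nuclear_costsP T s).1 Ts.
  have [s' s's [lam [v [lam0 Vv TE lams]]]] := conic_caratheodory Vv0 conicT.
  pose g : {ffun 'I_N * option idx -> R} :=
    [ffun ja => if ja.2 is Some a then v ja.1 a else lam ja.1].
  exists g; split.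
  - by move=> j; rewrite ffunE; exact: lam0.
  - move=> j; have -> : [ffun a => g (j, Some a)] = v j by apply/ffunP => a; rewrite !ffunE.
    exact: Vv.
  - by move=> a; rewrite TE; apply: eq_bigr => j _; rewrite !ffunE.
  - under eq_bigr do rewrite ffunE /=; rewrite lams (le_trans s's) // ltW //.
    by apply: lt_le_trans lts _; rewrite lerD2r.
have Cmono e e' : e <= e' -> C e `<=` C e'.
  by move=> ee' g [? ? ? le]; split=> //; apply: le_trans le _; rewrite lerD2l.
(* Entries of unit tensors are at most 1 in absolute value, and the nonnegative weights sum to at
   most [1 + 1]. *)
have CB g : C 1 g -> forall i, - 2 <= g i <= 2.
  move=> [g0 Vg _ gle] [j [a|]].
    have /zero_locus_I2[_] := Vg j; rewrite /sqnorm (bigD1 a) //= ffunE => sq1.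
    have : g (j, Some a) ^+ 2 <= 1.
      by rewrite -[X in _ <= X]sq1 lerDl sumr_ge0 // => b _; apply: sqr_ge0.
    by move=> le1; apply/andP; split; nra.
  rewrite (le_trans _ (g0 j)) ?oppr_le0 // (le_trans _ gle) //.
  by rewrite (bigD1 j) //= lerDl sumr_ge0.
have [g Hg] := polynomial_compactness C0 Cmono CB.
(* An equation is the pair of inequalities for [q] and [- q]. *)
have Hg0 q : (forall h, C 1 h -> peval h q = 0) -> peval g q = 0.
  move=> q0; apply/eqP; rewrite eq_le; apply/andP; split; last first.
    by apply: (Hg q 1) => // h /q0->.
  rewrite -oppr_ge0 -rmorphN; apply: (Hg (- q) 1) => // h /q0 hq.
  by rewrite rmorphN /= hq oppr0.
pose y j o := var R ((j, o) : 'I_N * option idx).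
have Vg j : V [ffun a => g (j, Some a)].
  apply/zero_locus_I2; split; last first.
    apply/eqP; rewrite -subr_eq0.
    have := Hg0 (\sum_a y j (Some a) ^+ 2 - 1).
    have pE h : peval h (\sum_a y j (Some a) ^+ 2 - 1) = sqnorm [ffun a => h (j, Some a)] - 1.
      rewrite rmorphB rmorph1 rmorph_sum /=; congr (_ - _); apply: eq_bigr => a _.
      by rewrite rmorphXn /= peval_var ffunE.
    rewrite pE => ->// h [_ Vh _ _]; rewrite pE.
    by have /zero_locus_I2[_ ->] := Vh j; rewrite subrr.
  apply/zero_locus_I0 => a b; apply/eqP; rewrite -subr_eq0 !ffunE.
  have := Hg0 (y j (Some a) * y j (Some b) -
               y j (Some (idx_join a b)) * y j (Some (idx_meet a b))).
  rewrite rmorphB !rmorphM /= !peval_var => -> // h [_ Vh _ _].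
  rewrite rmorphB !rmorphM /= !peval_var.
  have /zero_locus_I2[/zero_locus_I0/(_ a b) + _] := Vh j.
  by rewrite !ffunE => ->; rewrite subrr.
have sumE h : peval h (\sum_j y j None) = \sum_j h (j, None).
  by rewrite rmorph_sum; apply: eq_bigr => j _; rewrite /= peval_var.
exists N, (\sum_j g (j, None)); split.
  apply/ler_addgt0Pr => e e0; rewrite -subr_ge0.
  have pE h : peval h ((1 + e)%:A - \sum_j y j None) = 1 + e - \sum_j h (j, None).
    by rewrite rmorphB /= pevalZ rmorph1 mulr1 sumE.
  by rewrite -pE; apply: (Hg _ e) => // h [_ _ _ le]; rewrite pE subr_ge0.
exists (fun j => g (j, None)), (fun j => [ffun a => g (j, Some a)]); split=> //.
- move=> j; rewrite -peval_var; apply: (Hg _ 1) => // h [h0 _ _ _].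
  by rewrite peval_var.
- move=> a; apply/eqP; rewrite -subr_eq0.
  have pE h : peval h ((T a)%:A - \sum_j y j None * y j (Some a)) =
              T a - \sum_j h (j, None) * h (j, Some a).
    rewrite rmorphB /= pevalZ rmorph1 mulr1 rmorph_sum; congr (_ - _).
    by apply: eq_bigr => j _; rewrite rmorphM /= !peval_var.
  under eq_bigr do rewrite ffunE.
  by rewrite -pE Hg0 // => h [_ _ TE _]; rewrite pE TE subrr.
Qed.

Lemma nuclear_ballE : nuclear_ball R d n = convex_hull V.
Proof.
apply/seteqP; split=> T.
  move=> /nuclear_norm_attained[m [s [s1 conicT]]].
  have [v0 Vv0] := zero_locus_I2_nonempty R n_gt0.
  (* The missing weight [1 - s] is split evenly between [v0] and its opposite, which cancel. *)
  have c0 : 0 <= (1 - s) / 2 by rewrite divr_ge0 ?subr_ge0.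
  have := conic_cons c0 (scaleN_I2 Vv0) (conic_cons c0 Vv0 conicT).
  move=> [lam [v [lam0 Vv TE lam1]]]; exists m.+2, lam, v; split=> //.
    by rewrite lam1; field.
  by apply/ffunP => a; have := TE a; rewrite !ffunE => <-; ring.
move=> [m [lam [v [lam0 lam1 Vv TE]]]].
apply: ge_inf; first by case: (nuclear_costs_has_inf T).
apply/nuclear_costsP; exists m, lam, v; split=> // a.
by rewrite TE ffunE.
Qed.

End NuclearBall.

(** If every [n i] is 1, there is a single variable [x], and [I2] is generated by [x ^+ 2 - 1],
    which factors and has the two real zeros 1 and -1. Primality and irreducibility are therefore
    stated for the case where some [n i] exceeds 1. *)
Theorem theorem2 (R : realType) (d : nat) (n : 'I_d -> nat)
    (d_gt0 : (0 < d)%N) (n_gt0 : forall i : 'I_d, (0 < n i)%N) :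
  is_real_radical (I2 R d n) /\
  ((exists i : 'I_d, (1 < n i)%N) ->
     is_prime_ideal (I2 R d n) /\ zariski_irreducible (zero_locus (I2 R d n))) /\
  nuclear_ball R d n = convex_hull (zero_locus (I2 R d n)) /\
  is_real_radical (I0 R d n) /\
  is_real_radical (I1 R d n) /\
  is_real_radical (Iinfty R d n).
Proof.
split; first by apply: vanishing_real_radical; exact: vanishing_I2.
split; first by move=> [j nj]; split; [exact: prime_I2 nj|exact: irreducible_I2 nj].
split; first exact: nuclear_ballE.
split; first by apply: vanishing_real_radical; exact: vanishing_I0.
by split; [exact: real_radical_I1|exact: real_radical_Iinfty].
Qed.
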